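(* Let $\mathrm{Err}$ be a good error function. Given $0<\epsilon<1/2$ and $0\le\eta<1/2$, there exists $C=C(\epsilon,\eta)>0$ such that for every $0<\theta\le1$ there is $N$ such that for all $n\ge N$ the following holds: for every $\mathbf{p},\mathbf{p}'\in[\epsilon,1-\epsilon]^n$ with $|p_i-p_i'|\ge\epsilon$ for all $i$, if $\bm\beta^*=(\beta_0,\dots,\beta_n)$ is the risk-minimizing linear solution of $(\mathbf{X},Y)$ for $(\mathbf{X},Y,Z)\sim\mathcal{D}^\eta_{\mathbf{p},\mathbf{p}'}$ and $\hat Y=\beta_0+\sum_{i=1}^n\beta_iX_i$, then $$\mathbb{P}_{(\mathbf{X},Y,Z)\sim\mathcal{D}^\eta_{\mathbf{p},\mathbf{p}'}}\Big[YZ=-1\ \Big|\ F\big(\mathrm{Err}(\hat Y,Y)\big)\ge1-\theta\Big]\ \ge\ \min\Big(1,\frac{\eta}{\theta}\Big)-\frac{C}{\sqrt n},$$ where $F$ is the CDF of $\mathrm{Err}(\hat Y,Y)$ under $\mathcal{D}^\eta_{\mathbf{p},\mathbf{p}'}$.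
   Context: A function $\mathrm{Err}:\mathbb{R}\times\{-1,1\}\to\mathbb{R}$ is a good error function if (1) for all $(\hat y_1,y_1),(\hat y_2,y_2)\in\mathbb{R}\times\{-1,1\}$ with $\hat y_1y_1>0$ and $\hat y_2y_2\le0$ we have $\mathrm{Err}(\hat y_1,y_1)<\mathrm{Err}(\hat y_2,y_2)$, and (2) for all $\hat y_1\ne\hat y_2$ and $y\in\{-1,1\}$, $\mathrm{Err}(\hat y_1,y)\ne\mathrm{Err}(\hat y_2,y)$. For $\mathbf{q}\in[0,1]^n$, $\mathcal{B}_{\mathbf{q}}$ is the law of independent $X_i\in\{-1,1\}$ with $\mathbb{P}[X_i=1]=q_i$. The toy distribution $\mathcal{D}^{\eta}_{\mathbf{p},\mathbf{p}'}$: sample $Z$ uniformly from $\{-1,1\}$; if $Z=1$ sample $\mathbf{X}\sim\mathcal{B}_{\mathbf{p}}$, else $\mathbf{X}\sim\mathcal{B}_{\mathbf{p}'}$; set $Y=Z$ with probability $1-\eta$ and $Y=-Z$ with probability $\eta$. The risk-minimizing linear solution is $\bm\beta^*=\arg\min_{\bm\beta}\mathbb{E}(\beta_0+\sum_i\beta_iX_i-Y)^2$. For a random variable $V$, $F(V)$ denotes its CDF $F_V(v)=\mathbb{P}[V\le v]$ evaluated at $V$. *)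

(* Defs.v *)
(* finite (discrete) probability over the finite sample space
   Z x X x Y, with Z, Y, X_i in {-1,1} encoded by booleans (true = +1). *)
From HB Require Import structures.
From mathcomp Require Import all_boot all_order all_algebra.
From mathcomp Require Import reals.
Set Implicit Arguments. Unset Strict Implicit. Unset Printing Implicit Defensive.
Import Order.TTheory GRing.Theory Num.Theory.
Local Open Scope ring_scope.

Section Toy.
Variable R : realType.

Definition sgn (b : bool) : R := if b then 1 else -1.

Definition good_error_function (Err : R -> bool -> R) : Prop :=
  (forall yh1 y1 yh2 y2, 0 < yh1 * sgn y1 -> yh2 * sgn y2 <= 0 ->
      Err yh1 y1 < Err yh2 y2) /\
  (forall yh1 yh2 y, yh1 != yh2 -> Err yh1 y != Err yh2 y).

Definition outcome (n : nat) := (bool * {ffun 'I_n -> bool} * bool)%type.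

Definition bern (q : R) (b : bool) : R := if b then q else 1 - q.

Definition toy_pmf n (eta : R) (p p' : 'I_n -> R) (w : outcome n) : R :=
  let: (z, x, y) := w in
  (1 / 2) * (\prod_(i < n) bern (if z then p i else p' i) (x i)) *
  (if y == z then 1 - eta else eta).

Definition toy_Pr n eta (p p' : 'I_n -> R) (A : pred (outcome n)) : R :=
  \sum_(w : outcome n | A w) toy_pmf eta p p' w.

Definition toy_E n eta (p p' : 'I_n -> R) (f : outcome n -> R) : R :=
  \sum_(w : outcome n) toy_pmf eta p p' w * f w.

Definition toy_condPr n eta (p p' : 'I_n -> R) (A B : pred (outcome n)) : R :=
  toy_Pr eta p p' [pred w | A w && B w] / toy_Pr eta p p' B.

Definition outZ n (w : outcome n) : bool := w.1.1.
Definition outX n (w : outcome n) : {ffun 'I_n -> bool} := w.1.2.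
Definition outY n (w : outcome n) : bool := w.2.

Definition linpred n (b0 : R) (b : 'I_n -> R) (x : {ffun 'I_n -> bool}) : R :=
  b0 + \sum_(i < n) b i * sgn (x i).

Definition risk n eta (p p' : 'I_n -> R) (b0 : R) (b : 'I_n -> R) : R :=
  toy_E eta p p' (fun w => (linpred b0 b (outX w) - sgn (outY w)) ^+ 2).

Definition risk_minimizer n eta (p p' : 'I_n -> R) (b0 : R) (b : 'I_n -> R) : Prop :=
  forall c0 (c : 'I_n -> R), risk eta p p' b0 b <= risk eta p p' c0 c.

Definition toy_cdf n eta (p p' : 'I_n -> R) (V : outcome n -> R) (v : R) : R :=
  toy_Pr eta p p' [pred w | V w <= v].

End Toy.

(* Main.v *)
(* The normal equations show that the risk minimizer is a positive multiple of
   Fisher's discriminant: every b_i is nonzero, and given Z the predictor has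
   mean Z t, where t^2 exceeds its variance by a factor of order n.
   By Chebyshev its sign is Z up to probability O(1/n), so the misclassified
   points are, up to O(1/n), the flipped ones. As a good error function ranks
   misclassified points above all others, the tail event of mass about theta
   is comparable with the set of misclassified points. The overshoot of the
   tail above theta is at most one atom of the error, hence at most one atom of
   a sum of n independent nondegenerate biased signs with nonzero coefficients,
   which is O(1/sqrt n) by a Littlewood-Offord bound. That bound is proved by
   induction on n for all finite sets at once: two distinct translates of a
   finite set of reals have a union strictly larger and an intersection
   strictly smaller than the set, so the best bound in terms of cardinality
   satisfies a discrete heat inequality. *)
Require Import Defs.
From HB Require Import structures.
From mathcomp Require Import all_boot all_order all_algebra.
From mathcomp Require Import reals.
From mathcomp Require Import ring lra.
Import Order.TTheory GRing.Theory Num.Theory.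
Local Open Scope ring_scope.

(** * Expectations and covariances under a product of Bernoulli laws *)

Section BernoulliProduct.
Context {R : realType}.

Definition bern_ex {n : nat} (q : 'I_n -> R) (f : {ffun 'I_n -> bool} -> R) : R :=
  \sum_(x : {ffun 'I_n -> bool}) (\prod_(i < n) bern (q i) (x i)) * f x.

Definition ffun_cons {n : nat} (t : bool) (x : {ffun 'I_n -> bool}) :
    {ffun 'I_n.+1 -> bool} :=
  [ffun i => if unlift ord0 i is Some j then x j else t].

Lemma ffun_cons0 n t (x : {ffun 'I_n -> bool}) : ffun_cons t x ord0 = t.
Proof. by rewrite ffunE unlift_none. Qed.

Lemma ffun_consS n t (x : {ffun 'I_n -> bool}) j :
  ffun_cons t x (lift ord0 j) = x j.
Proof. by rewrite ffunE liftK. Qed.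

Lemma bern_ex0 (q : 'I_0 -> R) f : bern_ex q f = f [ffun=> false].
Proof.
rewrite /bern_ex (bigD1 [ffun=> false]) //= big_ord0 mul1r big1 ?addr0 // => x.
by case/eqP; apply/ffunP => - [].
Qed.

Lemma bern_exS n (q : 'I_n.+1 -> R) f :
  bern_ex q f = \sum_(t : bool) bern (q ord0) t *
    bern_ex (fun i => q (lift ord0 i)) (fun x => f (ffun_cons t x)).
Proof.
rewrite /bern_ex; under [RHS]eq_bigr => t _ do rewrite big_distrr /=.
rewrite pair_big /= (reindex (fun tx : bool * {ffun 'I_n -> bool} => ffun_cons tx.1 tx.2)) /=.
  apply: eq_bigr => -[t x] _ /=; rewrite big_ord_recl ffun_cons0 mulrA.
  by congr (_ * _ * _); apply: eq_bigr => i _; rewrite ffun_consS.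
exists (fun y => (y ord0, [ffun j => y (lift ord0 j)])) => [[t x] _|y _] /=.
  rewrite ffun_cons0; congr (_, _); apply/ffunP => j.
  by rewrite ffunE ffun_consS.
apply/ffunP => i; case: (unliftP ord0 i) => [j|] ->; rewrite ?ffun_consS ?ffun_cons0 //.
by rewrite ffunE.
Qed.

Lemma bern_ex_ext n (q : 'I_n -> R) f g : f =1 g -> bern_ex q f = bern_ex q g.
Proof. by move=> fg; apply: eq_bigr => x _; rewrite fg. Qed.

Lemma bern_exD n (q : 'I_n -> R) f g :
  bern_ex q (fun x => f x + g x) = bern_ex q f + bern_ex q g.
Proof. by rewrite -big_split; apply: eq_bigr => x _; rewrite mulrDr. Qed.

Lemma bern_exZ n (q : 'I_n -> R) c f :
  bern_ex q (fun x => c * f x) = c * bern_ex q f.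
Proof. by rewrite /bern_ex big_distrr; apply: eq_bigr => x _; rewrite mulrCA. Qed.

Lemma bern_ex1 n (q : 'I_n -> R) : bern_ex q (fun=> 1) = 1.
Proof.
elim: n q => [|n IH] q; first by rewrite bern_ex0.
by rewrite bern_exS big_bool !IH /bern /=; ring.
Qed.

Lemma bern_ex_cst n (q : 'I_n -> R) c : bern_ex q (fun=> c) = c.
Proof.
by rewrite -[RHS]mulr1 -(bern_ex1 n q) -bern_exZ; apply: bern_ex_ext => x; rewrite mulr1.
Qed.

Lemma bern_prod_ge0 n (q : 'I_n -> R) x : (forall i, 0 <= q i <= 1) ->
  0 <= \prod_(i < n) bern (q i) (x i).
Proof.
move=> hq; apply: prodr_ge0 => i _; have /andP[h0 h1] := hq i.
by rewrite /bern; case: (x i); rewrite ?subr_ge0.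
Qed.

Lemma bern_ex_le n (q : 'I_n -> R) f g : (forall i, 0 <= q i <= 1) ->
  (forall x, f x <= g x) -> bern_ex q f <= bern_ex q g.
Proof.
by move=> hq fg; apply: ler_sum => x _; apply: ler_wpM2l => //; apply: bern_prod_ge0.
Qed.

Definition lin_centered {n : nat} (q b : 'I_n -> R) (x : {ffun 'I_n -> bool}) : R :=
  \sum_(i < n) b i * (sgn R (x i) - (2 * q i - 1)).

Lemma lin_centered_cons n (q b : 'I_n.+1 -> R) t x :
  lin_centered q b (ffun_cons t x) = b ord0 * (sgn R t - (2 * q ord0 - 1)) +
   lin_centered (fun i => q (lift ord0 i)) (fun i => b (lift ord0 i)) x.
Proof.
rewrite /lin_centered big_ord_recl ffun_cons0; congr (_ + _).
by apply: eq_bigr => i _; rewrite ffun_consS.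
Qed.

Lemma linpred_centered n (q : 'I_n -> R) b0 b x :
  linpred b0 b x = (b0 + \sum_(i < n) b i * (2 * q i - 1)) + lin_centered q b x.
Proof.
rewrite /linpred /lin_centered -addrA -big_split; congr (_ + _).
by apply: eq_bigr => i _ /=; ring.
Qed.

Lemma bern_ex_lin n (q b : 'I_n -> R) : bern_ex q (lin_centered q b) = 0.
Proof.
elim: n q b => [|n IH] q b; first by rewrite bern_ex0 /lin_centered big_ord0.
rewrite bern_exS big_bool.
rewrite !(bern_ex_ext _ _ _ _ (lin_centered_cons _ q b _)).
by rewrite !bern_exD !bern_ex_cst !IH /bern /sgn /=; ring.
Qed.

(** Cross terms vanish by independence and centering; [4 * q i * (1 - q i)] is the variance of a
    sign that equals [1] with probability [q i]. *)
Lemma bern_ex_cov n (q b c : 'I_n -> R) :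
  bern_ex q (fun x => lin_centered q b x * lin_centered q c x) =
  \sum_(i < n) b i * c i * (4 * q i * (1 - q i)).
Proof.
elim: n q b c => [|n IH] q b c; first by rewrite bern_ex0 /lin_centered !big_ord0 mulr0.
rewrite bern_exS big_bool big_ord_recl -IH.
set Q := fun i => q (lift ord0 i); set B := fun i => b (lift ord0 i).
set D := fun i => c (lift ord0 i).
have E t : bern_ex Q (fun x => lin_centered q b (ffun_cons t x)
                               * lin_centered q c (ffun_cons t x)) =
   b ord0 * c ord0 * (sgn R t - (2 * q ord0 - 1)) ^+ 2 +
   bern_ex Q (fun x => lin_centered Q B x * lin_centered Q D x).
  transitivity (bern_ex Q (fun x => b ord0 * c ord0 * (sgn R t - (2 * q ord0 - 1)) ^+ 2 +
    (b ord0 * (sgn R t - (2 * q ord0 - 1)) * lin_centered Q D x +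
    (c ord0 * (sgn R t - (2 * q ord0 - 1)) * lin_centered Q B x +
     lin_centered Q B x * lin_centered Q D x)))).
    by apply: bern_ex_ext => x; rewrite !lin_centered_cons -/Q -/B -/D; ring.
  by rewrite !bern_exD !bern_exZ !bern_ex_lin bern_ex_cst; ring.
by rewrite !E /bern /sgn /=; ring.
Qed.

End BernoulliProduct.

(** * Littlewood-Offord bound for biased signs *)

Section LittlewoodOfford.
Context {R : realType}.

(** If [A + d] were contained in [A], the two would be equal by cardinality, and comparing the sums
    of their elements would give [|A| * d = 0]. *)
Lemma translates_differ (A : seq R) (d : R) : d != 0 -> A != [::] -> uniq A ->
  exists2 a, a \in A & a + d \notin A.
Proof.
move=> d0 A0 uA; apply/hasP/negPn/negP => /hasPn h.
have sub : {subset map (+%R^~ d) A <= A} by move=> _ /mapP[a /h/negPn aA ->].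
have uB : uniq (map (+%R^~ d) A) by rewrite map_inj_uniq //; apply: addIr.
have [|_ eqm] := uniq_min_size uB sub _; first by rewrite size_map.
have /esym : \sum_(a <- A) a = \sum_(a <- map (+%R^~ d) A) a.
  by apply: perm_big; rewrite perm_sym uniq_perm.
rewrite big_map big_split /= -[RHS]addr0 => /addrI.
rewrite big_const_seq count_predT iter_addr_0 => /eqP.
by rewrite mulrn_eq0 (negbTE d0) orbF size_eq0 (negbTE A0).
Qed.

(** Finite sets replace single points because the induction takes unions and intersections of
    translates. *)
Definition lin_conc {n : nat} (q b : 'I_n -> R) (A : seq R) : R :=
  bern_ex q (fun x => ((\sum_(i < n) b i * sgn R (x i)) \in A)%:R).

(** Conditioning on the first sign turns its contribution into a translation of the target set. *)
Lemma lin_concS n (q b : 'I_n.+1 -> R) A :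
  lin_conc q b A =
  q ord0 * lin_conc (fun i => q (lift ord0 i)) (fun i => b (lift ord0 i))
     (map (+%R^~ (- b ord0)) A) +
  (1 - q ord0) * lin_conc (fun i => q (lift ord0 i)) (fun i => b (lift ord0 i))
     (map (+%R^~ (b ord0)) A).
Proof.
have memshift (c a : R) : (a \in map (+%R^~ c) A) = (a - c \in A).
  by rewrite -[in LHS](subrK c a) (mem_map (f := +%R^~ c)) //; apply: addIr.
rewrite /lin_conc bern_exS big_bool /bern; congr (_ * _ + _ * _);
  apply: bern_ex_ext => x; rewrite memshift big_ord_recl ffun_cons0 /sgn;
  congr ((_ \in A)%:R : R); rewrite addrC ?mulr1 ?mulrN1 ?opprK; congr (_ + _);
  by apply: eq_bigr => i _; rewrite ffun_consS.
Qed.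

Lemma lin_conc_le1 n (q b : 'I_n -> R) A : (forall i, 0 <= q i <= 1) ->
  lin_conc q b A <= 1.
Proof.
move=> hq; rewrite -(bern_ex1 n q); apply: bern_ex_le => // x.
by case: (_ \in _).
Qed.

Lemma lin_conc_cupcap n (q b : 'I_n -> R) A1 A2 :
  lin_conc q b A1 + lin_conc q b A2 =
  lin_conc q b (A1 ++ [seq a <- A2 | a \notin A1]) +
  lin_conc q b [seq a <- A2 | a \in A1].
Proof.
rewrite /lin_conc -!bern_exD; apply: bern_ex_ext => x.
rewrite mem_cat !mem_filter.
by case: (_ \in A1); case: (_ \in A2); rewrite /= ?addr0 ?add0r.
Qed.

(** One time step of the profile: growing [L ^+ 2] by [e] costs at most [3 * e / (2 * L ^+ 2)] in
    the linear term, and the quadratic term moves in the favourable direction. *)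
Lemma concave_profile_step (e r L L' : R) : 0 < e -> 0 < L -> 0 < L' ->
  L' ^+ 2 = L ^+ 2 + e -> 0 <= r -> r <= L' / 2 ->
  3 * (r / L) - (r / L) ^+ 2 - 2 * e / L ^+ 2 <= 3 * (r / L') - (r / L') ^+ 2.
Proof.
move=> e0 L0 L'0 hL r0 rL.
have LL' : L < L' by rewrite -(@ltr_pXn2r R 2) ?nnegrE ?ltW // hL; lra.
have sq : (r / L') ^+ 2 <= (r / L) ^+ 2.
  have L0' := ltW L0; have L'0' := ltW L'0.
  rewrite ler_pXn2r ?nnegrE ?divr_ge0 //.
  by apply: ler_wpM2l => //; rewrite lef_pV2 ?posrE // ltW.
have h : r / L - r / L' <= e / (2 * L ^+ 2).
  have -> : r / L - r / L' = (r / L') * ((L' - L) / L).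
    by field; rewrite ?gt_eqF.
  have -> : e / (2 * L ^+ 2) = (1 / 2) * (e / L ^+ 2).
    by field; rewrite ?gt_eqF.
  apply: ler_pM.
  - by rewrite divr_ge0 // ltW.
  - by rewrite divr_ge0 // ?subr_ge0 ltW.
  - by rewrite ler_pdivrMr //; lra.
  rewrite ler_pdivrMr // -mulrA expr2 invfM -[_ * L]mulrA mulVf ?gt_eqF // mulr1.
  by rewrite ler_pdivlMr //; nra.
have : 0 <= e / L ^+ 2 by rewrite divr_ge0 ?exprn_ge0 // ltW.
have E : e / (2 * L ^+ 2) = (1 / 2) * (e / L ^+ 2) by field; rewrite ?gt_eqF.
rewrite E in h; rewrite -mulrA; lra.
Qed.

(** If every [a + d] had the form [c - d] with [c] in [A], then [A] would be stable under
    translation by [2 d]. *)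
Lemma translates_overlap (A : seq R) (d : R) : d != 0 -> A != [::] -> uniq A ->
  (size [seq a <- map (+%R^~ d) A | a \in map (+%R^~ (- d)) A] < size A)%N.
Proof.
move=> d0 A0 uA; have [|a aA naA] := translates_differ A (d + d) _ A0 uA.
  by rewrite -mulr2n mulrn_eq0.
rewrite size_filter -[X in (_ < X)%N](size_map (+%R^~ d)) ltn_neqAle count_size andbT.
rewrite -all_count; apply/allPn; exists (a + d); first exact: map_f.
apply: contra naA => /mapP[c cA /(congr1 (+%R^~ d))].
by rewrite subrK -addrA => ->.
Qed.

(* The profile [3 x - x^2], with [x = |A| / L] and [L^2] growing linearly in
   [n], is a supersolution of the lazy heat equation
   [u_(n+1) r = e u_n (r+1) + e u_n (r-1) + (1 - 2e) u_n r]; it exceeds [1]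
   on [1/2 <= x <= 2], so nothing has to be proved there. *)
Lemma lin_conc_profile (e : R) n (q b : 'I_n -> R) A : 0 < e -> e < 1 / 2 ->
  (forall i, e <= q i <= 1 - e) -> (forall i, b i != 0) -> uniq A ->
  let L := Num.sqrt (e * n.+1%:R) in
  (size A)%:R <= 2 * L ->
  lin_conc q b A <= 3 * ((size A)%:R / L) - ((size A)%:R / L) ^+ 2.
Proof.
move=> e0 e1; elim: n q b A => [|n IH] q b A hq hb uA L.
all: have L0 : 0 < L by rewrite sqrtr_gt0 mulr_gt0.
all: have L2 := sqr_sqrtr (ltW (mulr_gt0 e0 (ltr0Sn R _))) : L ^+ 2 = _.
all: have hq' i : 0 <= q i <= 1 by have /andP[? ?] := hq i; apply/andP; split; lra.
all: have [->|A0] := eqVneq A [::].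
1,3: by move=> _; rewrite mul0r mulr0 expr0n subr0 -(bern_ex_cst _ q 0); apply: bern_ex_le.
all: have A1 : 1 <= (size A)%:R :> R by rewrite ler1n lt0n size_eq0.
all: set r := (size A)%:R in A1 *; move=> rL.
all: have big : L / 2 <= r -> lin_conc q b A <= 3 * (r / L) - (r / L) ^+ 2.
1,3: move=> Lr; apply: le_trans (lin_conc_le1 _ q b A hq') _.
1,2: have : 1 / 2 <= r / L by rewrite ler_pdivlMr //; lra.
1,2: have : r / L <= 2 by rewrite ler_pdivrMr.
1,2: by set x := r / L; nra.
  (* For [n = 0], [L ^+ 2 = e < 1 / 2], hence [L / 2 < 1 <= r]. *)
  by apply: big; rewrite mulr1 in L2; nra.
have [/big//|rL2] := leP (L / 2) r.
set q1 := fun i => q (lift ord0 i); set b1 := fun i => b (lift ord0 i).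
set M := Num.sqrt (e * n.+1%:R).
have M0 : 0 < M by rewrite sqrtr_gt0 mulr_gt0.
have M2 : M ^+ 2 = e * n.+1%:R by rewrite sqr_sqrtr // mulr_ge0 // ltW.
have LM : L ^+ 2 = M ^+ 2 + e by rewrite L2 M2 -[n.+2]addn1 natrD; ring.
(* Since [2 r < L <= 2 M], even the union of the two translates meets the size bound of the
   induction hypothesis. *)
have LM2 : L <= 2 * M.
  rewrite -(@ler_pXn2r R 2) ?nnegrE ?mulr_ge0 ?ltW // exprMn LM M2.
  have : 1 <= n.+1%:R :> R by rewrite ler1n.
  by nra.
apply: le_trans (concave_profile_step e r M L e0 M0 L0 LM _ _); try lra.
have {}IH B : uniq B -> (size B)%:R <= 2 * M ->
  lin_conc q1 b1 B <= 3 * ((size B)%:R / M) - ((size B)%:R / M) ^+ 2.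
  by apply: IH => i; [exact: hq | exact: hb].
rewrite lin_concS -/q1 -/b1; set d := b ord0.
set AL := map _ A; set AR := map _ A.
have uL : uniq AL by rewrite map_inj_uniq //; apply: addIr.
have uR : uniq AR by rewrite map_inj_uniq //; apply: addIr.
have sL : size AL = size A by rewrite size_map.
have sR : size AR = size A by rewrite size_map.
have hL := IH AL uL; have hR := IH AR uR; rewrite sL -/r in hL; rewrite sR -/r in hR.
have {}hL := hL ltac:(lra); have {}hR := hR ltac:(lra).
have cc := lin_conc_cupcap _ q1 b1 AL AR.
have uI : uniq [seq a <- AR | a \in AL] by rewrite filter_uniq.
have uU : uniq (AL ++ [seq a <- AR | a \notin AL]).
  rewrite cat_uniq uL filter_uniq // andbT; apply/hasPn => a.
  by rewrite mem_filter => /andP[].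
have ov : (size [seq a <- AR | a \in AL] < size A)%N.
  exact: translates_overlap (hb ord0) A0 uA.
have sU : (size (AL ++ [seq a <- AR | a \notin AL]) + size [seq a <- AR | a \in AL]
  = size A + size A)%N.
  rewrite size_cat sL -addnA; congr addn.
  by rewrite addnC !size_filter -[RHS]sR -(count_predC (mem AL) AR).
have hI := IH _ uI; have hU := IH _ uU; move: hI hU.
set sI := size _ in ov sU *; set sV := size _ in sU *.
have sI1 : sI%:R <= r - 1 by rewrite lerBrDr natr1 ler_nat.
have sI0 : 0 <= sI%:R :> R by [].
have -> : sV%:R = r + r - sI%:R by rewrite -!natrD -sU natrD addrK.
move=> /(_ ltac:(lra)) hI /(_ ltac:(lra)) hU.
have /andP[q0 q0'] := hq ord0.
have inv : M^-1 ^+ 2 > 0 by rewrite exprn_gt0 // invr_gt0.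
(* The sizes [r, r] are replaced by [r + (r - s), r - (r - s)] with [r - s >= 1], where [s] is the
   size of the intersection; concavity then gains at least [2 / M ^+ 2]. *)
have key : lin_conc q1 b1 AL + lin_conc q1 b1 AR <=
    2 * (3 * (r / M) - (r / M) ^+ 2) - 2 / M ^+ 2.
  rewrite cc; apply: le_trans (lerD hU hI) _.
  rewrite -exprVn -subr_ge0.
  have -> : forall s : R, 2 * (3 * (r / M) - (r / M) ^+ 2) - 2 * M^-1 ^+ 2 -
     (3 * ((r + r - s) / M) - ((r + r - s) / M) ^+ 2 + (3 * (s / M) - (s / M) ^+ 2))
     = 2 * M^-1 ^+ 2 * ((r - s) ^+ 2 - 1) by move=> s; ring.
  by apply: mulr_ge0; [lra | nra].
move: key hL hR; rewrite -(mulrA 2 e) (mulrC e) (mulrA 2).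
set u := 3 * _ - _; set a1 := lin_conc _ _ AL; set a2 := lin_conc _ _ AR.
set w := 2 / M ^+ 2 => key hL hR.
(* Weight [e] is taken from each of [q ord0] and [1 - q ord0] for the symmetric estimate [key]; the
   remaining weights use the plain induction hypothesis. The total gain [e * w] pays for the time
   step. *)
have : e * (a1 + a2) <= e * (2 * u - w) by rewrite ler_pM2l.
have : (q ord0 - e) * a1 <= (q ord0 - e) * u by apply: ler_wpM2l; lra.
have : (1 - q ord0 - e) * a2 <= (1 - q ord0 - e) * u by apply: ler_wpM2l; lra.
by lra.
Qed.

(** The profile of a singleton is at most [3 / L], with [L ^+ 2 = e * (n + 1) >= e * n]. *)
Lemma linpred_atom (e : R) n (q b : 'I_n -> R) (b0 t : R) : 0 < e -> e < 1 / 2 ->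
  (forall i, e <= q i <= 1 - e) -> (forall i, b i != 0) -> (0 < n)%N ->
  bern_ex q (fun x => (linpred b0 b x == t)%:R) <= 3 / Num.sqrt e / Num.sqrt n%:R.
Proof.
move=> e0 e1 hq hb n0.
have -> : bern_ex q (fun x => (linpred b0 b x == t)%:R) = lin_conc q b [:: t - b0].
  by apply: bern_ex_ext => x; rewrite inE /linpred -(subr_eq0 (_ + _)) -(subr_eq0 (\sum_i _)) opprB addrCA addrA.
have n0' : 0 < n%:R :> R by rewrite ltr0n.
set L := Num.sqrt (e * n.+1%:R).
have L0 : 0 < L by rewrite sqrtr_gt0 mulr_gt0.
apply: (@le_trans _ _ (3 / L)); last first.
  rewrite -mulrA -invfM -(sqrtrM _ (ltW e0)) ler_pM2l // lef_pV2 ?posrE ?sqrtr_gt0 ?mulr_gt0 //.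
  by rewrite ler_wsqrtr // ler_pM2l // ler_nat.
have [h|h] := leP 1 (2 * L).
  have := lin_conc_profile e n q b [:: t - b0] e0 e1 hq hb isT h.
  have : 0 <= (1 / L) ^+ 2 by exact: sqr_ge0.
  by rewrite -/L /= mulrA mulr1; lra.
(* Here [L < 1 / 2], so [3 / L] exceeds the trivial bound [1]. *)
apply: le_trans (lin_conc_le1 _ q b _ _) _.
  by move=> i; have /andP[? ?] := hq i; apply/andP; split; lra.
by rewrite ler_pdivlMr //; lra.
Qed.

End LittlewoodOfford.

(** * Mass of an upper tail in a finite probability space *)

Section UpperTail.
Context {R : realType} {T : finType}.
Implicit Types (mu V : T -> R).

Lemma sum_subset_le mu (A B W : pred T) : (forall w, 0 <= mu w) ->
  (forall w, A w -> B w || W w) ->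
  \sum_(w | A w) mu w <= \sum_(w | B w) mu w + \sum_(w | W w) mu w.
Proof.
move=> mu0 AB; rewrite (big_mkcond A) (big_mkcond B) (big_mkcond W) -big_split /=.
apply: ler_sum => w _; have := AB w; have := mu0 w.
by case: (A w); case: (B w); case: (W w) => //= h hA; try lra; have := hA isT.
Qed.

(** Take [w] of largest value outside the tail: the complement of the tail lies in the sublevel set
    of [w], of mass below [1 - theta]. If there is no such [w], the tail has mass [1]. *)
Lemma upper_tail_ge mu V theta : (forall w, 0 <= mu w) -> \sum_w mu w = 1 ->
  theta <= 1 ->
  theta <= \sum_(w | 1 - theta <= \sum_(u | V u <= V w) mu u) mu w.
Proof.
move=> mu0 mu1 th1; pose B w := 1 - theta <= \sum_(u | V u <= V w) mu u.
change (theta <= \sum_(w | B w) mu w).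
have : \sum_w mu w = \sum_(w | B w) mu w + \sum_(w | ~~ B w) mu w by apply: bigID.
rewrite mu1 => E; suff : \sum_(w | ~~ B w) mu w <= 1 - theta \/ [forall w, B w].
  case=> [|/forallP aB]; first lra.
  have : \sum_(w | ~~ B w) mu w = 0 by apply: big_pred0 => w; rewrite aB.
  by lra.
have [aB|/forallPn[w0 w0B]] := boolP [forall w, B w]; [by right | left].
case: (arg_maxP (P := fun w => ~~ B w) V w0B) => w wB wmax.
move: (wB); rewrite /B -ltNge => /ltW; apply: le_trans.
have := sum_subset_le mu (fun u => ~~ B u) [pred u | V u <= V w] pred0 mu0.
by rewrite big_pred0_eq addr0; apply=> u /wmax /= ->.
Qed.

(** At a tail point [w] of least value, the mass strictly above [V w] is at most [theta]; the rest
    of the tail lies in the atom at [V w]. *)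
Lemma upper_tail_le mu V theta a : (forall w, 0 <= mu w) -> \sum_w mu w = 1 ->
  0 <= theta -> 0 <= a -> (forall v, \sum_(w | V w == v) mu w <= a) ->
  \sum_(w | 1 - theta <= \sum_(u | V u <= V w) mu u) mu w <= theta + a.
Proof.
move=> mu0 mu1 th0 a0 atoms; pose B w := 1 - theta <= \sum_(u | V u <= V w) mu u.
change (\sum_(w | B w) mu w <= theta + a).
have [/existsP[w0 w0B]|/existsPn nB] := boolP [exists w, B w]; last first.
  by rewrite big_pred0 ?addr_ge0 // => w; apply/negbTE/nB.
case: (arg_minP (P := B) V w0B) => w wB wmin.
have : \sum_u mu u = \sum_(u | V u <= V w) mu u + \sum_(u | ~~ (V u <= V w)) mu u.
  exact: bigID.
rewrite mu1 => E; move: (wB); rewrite /B => wB'.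
have : \sum_(w | B w) mu w <=
    \sum_(u | ~~ (V u <= V w)) mu u + \sum_(u | V u == V w) mu u.
  apply: (sum_subset_le mu B) => // u /wmin /=.
  by rewrite -ltNge le_eqVlt eq_sym orbC.
by have := atoms (V w); lra.
Qed.

End UpperTail.

(** * Normal equations, Fisher's discriminant and Chebyshev's inequality *)

Section ToyDistribution.
Context {R : realType} {n : nat}.
Implicit Types (p q : 'I_n -> R).

Lemma toy_E_cond eta p p' f : toy_E eta p p' f =
  (1 / 2) * (bern_ex p (fun x => (1 - eta) * f (true, x, true) + eta * f (true, x, false))
    + bern_ex p' (fun x => (1 - eta) * f (false, x, false) + eta * f (false, x, true))).
Proof.
transitivity (\sum_(z : bool) \sum_(x : {ffun 'I_n -> bool}) \sum_(y : bool)
    toy_pmf eta p p' (z, x, y) * f (z, x, y)).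
  by rewrite pair_bigA pair_bigA; apply: eq_bigr => -[[z x] y] _.
rewrite big_bool /bern_ex mulrDr !big_distrr /=.
by congr (_ + _); apply: eq_bigr => x _; rewrite big_bool /toy_pmf /=; ring.
Qed.

Lemma toy_PrE eta p p' (A : pred (outcome n)) :
  toy_Pr eta p p' A = toy_E eta p p' (fun w => (A w)%:R).
Proof.
rewrite /toy_Pr /toy_E big_mkcond; apply: eq_bigr => w _.
by case: (A w); rewrite ?mulr1 ?mulr0.
Qed.

Lemma quadratic_min (K Q : R) : 0 <= Q ->
  (forall s, 0 <= 2 * s * K + s ^+ 2 * Q) -> K = 0.
Proof.
(* The quadratic is minimal at [- K / Q]; adding [1] keeps the denominator positive when [Q = 0]. *)
move=> Q0 /(_ (- K / (Q + 1))) h.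
have Q1 : 0 < Q + 1 by lra.
have : 2 * (- K / (Q + 1)) * K + (- K / (Q + 1)) ^+ 2 * Q =
  - (K ^+ 2 * (Q + 2) / (Q + 1) ^+ 2) by field; rewrite gt_eqF.
move=> E; move: h; rewrite E oppr_ge0 pmulr_lle0 ?invr_gt0 ?exprn_gt0 //.
rewrite pmulr_lle0; last lra.
by move=> h; apply/eqP; rewrite -sqrf_eq0 eq_le h sqr_ge0.
Qed.

Lemma toy_pmf_ge0 eta p p' w : 0 <= eta <= 1 -> (forall i, 0 <= p i <= 1) ->
  (forall i, 0 <= p' i <= 1) -> 0 <= toy_pmf eta p p' w.
Proof.
case: w => [[z x] y] /andP[e0 e1] hp hp'; rewrite /toy_pmf.
apply: mulr_ge0; last by case: (y == z); lra.
by apply: mulr_ge0; [lra | case: z; apply: bern_prod_ge0].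
Qed.

(** The first variation of the risk in the direction [(c0, c)] vanishes: the residual is orthogonal
    to every affine function of [X]. *)
Lemma normal_equations eta p p' b0 b : 0 <= eta <= 1 ->
  (forall i, 0 <= p i <= 1) -> (forall i, 0 <= p' i <= 1) ->
  risk_minimizer eta p p' b0 b -> forall c0 c,
  toy_E eta p p'
    (fun w => (linpred b0 b (outX w) - sgn R (outY w)) * linpred c0 c (outX w)) = 0.
Proof.
move=> he hp hp' rm c0 c.
pose Q := toy_E eta p p' (fun w => linpred c0 c (outX w) ^+ 2).
apply: (@quadratic_min _ Q).
  by apply: sumr_ge0 => w _; rewrite mulr_ge0 ?sqr_ge0 ?toy_pmf_ge0.
move=> s; have := rm (b0 + s * c0) (fun i => b i + s * c i).
rewrite -subr_ge0; congr (0 <= _).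
rewrite /risk /Q /toy_E -sumrB !big_distrr -big_split /=; apply: eq_bigr => w _.
have -> : linpred (b0 + s * c0) (fun i => b i + s * c i) (outX w) =
  linpred b0 b (outX w) + s * linpred c0 c (outX w).
  rewrite /linpred mulrDr big_distrr /= addrACA -big_split; congr (_ + _).
  by apply: eq_bigr => i _ /=; ring.
by ring.
Qed.

Definition lin_mean (b0 : R) (b q : 'I_n -> R) : R :=
  b0 + \sum_(i < n) b i * (2 * q i - 1).

Lemma bern_ex_linpred_mul q b0 b c0 c k :
  bern_ex q (fun x => (linpred b0 b x - k) * linpred c0 c x) =
  (lin_mean b0 b q - k) * lin_mean c0 c q +
  \sum_(i < n) b i * c i * (4 * q i * (1 - q i)).
Proof.
transitivity (bern_ex q (fun x => (lin_mean b0 b q - k) * lin_mean c0 c q +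
  ((lin_mean b0 b q - k) * lin_centered q c x +
  (lin_mean c0 c q * lin_centered q b x + lin_centered q b x * lin_centered q c x)))).
  by apply: bern_ex_ext => x; rewrite !(linpred_centered _ q) -!/(lin_mean _ _ _); ring.
by rewrite !bern_exD !bern_exZ !bern_ex_lin bern_ex_cst bern_ex_cov; ring.
Qed.

(** The average over [Z] of the conditional variances of the sign [X i]. *)
Definition mean_var p p' (i : 'I_n) : R := 2 * (p i * (1 - p i) + p' i * (1 - p' i)).

(** Label noise enters only through the conditional mean of [Y] given [Z], which is
    [(1 - 2 * eta) * Z]. *)
Lemma mean_normal_equations eta p p' b0 b : 0 <= eta <= 1 ->
  (forall i, 0 <= p i <= 1) -> (forall i, 0 <= p' i <= 1) ->
  risk_minimizer eta p p' b0 b -> forall c0 c,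
  (lin_mean b0 b p - (1 - 2 * eta)) * lin_mean c0 c p +
  (lin_mean b0 b p' + (1 - 2 * eta)) * lin_mean c0 c p' +
  2 * \sum_(i < n) b i * c i * mean_var p p' i = 0.
Proof.
move=> he hp hp' rm c0 c.
have := normal_equations eta p p' b0 b he hp hp' rm c0 c; rewrite toy_E_cond.
have E1 x : (1 - eta) * ((linpred b0 b x - sgn R true) * linpred c0 c x) +
  eta * ((linpred b0 b x - sgn R false) * linpred c0 c x) =
  (linpred b0 b x - (1 - 2 * eta)) * linpred c0 c x by rewrite /sgn; ring.
have E2 x : (1 - eta) * ((linpred b0 b x - sgn R false) * linpred c0 c x) +
  eta * ((linpred b0 b x - sgn R true) * linpred c0 c x) =
  (linpred b0 b x - (- (1 - 2 * eta))) * linpred c0 c x by rewrite /sgn; ring.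
rewrite /outX /outY /= (bern_ex_ext _ _ _ _ E1) (bern_ex_ext _ _ _ _ E2).
rewrite !bern_ex_linpred_mul => h.
suff : 2 * \sum_(i < n) b i * c i * mean_var p p' i =
  \sum_(i < n) b i * c i * (4 * p i * (1 - p i)) +
  \sum_(i < n) b i * c i * (4 * p' i * (1 - p' i)) by lra.
rewrite big_distrr -big_split; apply: eq_bigr => i _ /=.
by rewrite /mean_var; ring.
Qed.

(* [k] is the proportionality constant of Fisher's discriminant,
   [b i = k * (p i - p' i) / mean_var p p' i]; the two conditional means of
   the predictor are [t] and [- t]. *)
Lemma risk_minimizer_discriminant (e eta : R) p p' b0 b :
  0 < e -> 0 <= eta -> eta < 1 / 2 ->
  (forall i, e <= p i <= 1 - e) -> (forall i, e <= p' i <= 1 - e) ->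
  (forall i, e <= `|p i - p' i|) -> risk_minimizer eta p p' b0 b ->
  exists k t, [/\ 0 < k, lin_mean b0 b p = t, lin_mean b0 b p' = - t,
    n%:R * e ^+ 2 * k <= t &
    \sum_(i < n) b i * b i * mean_var p p' i = k * t] /\ forall i, b i != 0.
Proof.
move=> e0 eta0 eta1 hp hp' hd rm.
have hp1 i : 0 <= p i <= 1 by have /andP[? ?] := hp i; apply/andP; split; lra.
have hp'1 i : 0 <= p' i <= 1 by have /andP[? ?] := hp' i; apply/andP; split; lra.
have he : 0 <= eta <= 1 by apply/andP; split; lra.
have NE := mean_normal_equations eta p p' b0 b he hp1 hp'1 rm.
have meanE c0 c q : lin_mean c0 c q = c0 + lin_mean 0 c q by rewrite /lin_mean add0r.
have diffE c : lin_mean 0 c p - lin_mean 0 c p' = 2 * \sum_(i < n) c i * (p i - p' i).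
  rewrite /lin_mean !add0r -sumrB big_distrr; apply: eq_bigr => i _ /=; ring.
have sig0 i : 0 < mean_var p p' i.
  have /andP[a1 a2] := hp i; have /andP[c1 c2] := hp' i; rewrite /mean_var.
  by have := mulr_gt0 (lt_le_trans e0 a1) (_ : 0 < 1 - p i);
     have := mulr_gt0 (lt_le_trans e0 c1) (_ : 0 < 1 - p' i); lra.
have sig1 i : mean_var p p' i <= 1.
  rewrite /mean_var; have := sqr_ge0 (p i - 1 / 2); have := sqr_ge0 (p' i - 1 / 2).
  by nra.
set t := lin_mean b0 b p.
have tN : lin_mean b0 b p' = - t.
  have mean1 q : lin_mean 1 (fun=> 0) q = 1.
    by rewrite /lin_mean big1 ?addr0 // => i _; rewrite mul0r.
  (* Testing with the constant function makes the two conditional means opposite. *)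
  have := NE 1 (fun=> 0); rewrite !mean1 [X in _ + 2 * X]big1 => [|i _]; last first.
    by rewrite mulr0 mul0r.
  by rewrite -/t; lra.
(* The mean residuals are now [- k] for [Z = 1] and [k] for [Z = -1]. *)
pose k := 1 - 2 * eta - t.
have NEk c : \sum_(i < n) b i * c i * mean_var p p' i = k * \sum_(i < n) c i * (p i - p' i).
  have := NE 0 c; rewrite tN -/t.
  have -> : lin_mean 0 c p = lin_mean 0 c p' + 2 * \sum_(i < n) c i * (p i - p' i).
    by rewrite -diffE; ring.
  by rewrite /k; lra.
have tE : t = \sum_(i < n) b i * (p i - p' i).
  have := diffE b; have := tN; rewrite /t !(meanE b0); lra.
pose S := \sum_(i < n) (p i - p' i) ^+ 2 / mean_var p p' i.
have S_ge : n%:R * e ^+ 2 <= S.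
  rewrite -[n in n%:R]card_ord mulr_natl -sumr_const; apply: ler_sum => i _.
  rewrite ler_pdivlMr //; apply: (@le_trans _ _ (e ^+ 2)).
    by rewrite ler_piMr // exprn_ge0 // ltW.
  by rewrite -[leRHS]real_normK ?num_real // ler_pXn2r ?nnegrE // ltW.
have tS : t = k * S.
  (* Testing in Fisher's direction cancels [mean_var] and leaves [t] on the left. *)
  have := NEk (fun i => (p i - p' i) / mean_var p p' i).
  have -> : \sum_(i < n) (p i - p' i) / mean_var p p' i * (p i - p' i) = S.
    by apply: eq_bigr => i _; rewrite expr2 mulrAC.
  move=> <-; rewrite tE; apply: eq_bigr => i _; rewrite mulrA divfK //.
  by rewrite gt_eqF.
have S0 : 0 <= S by apply: le_trans S_ge; rewrite mulr_ge0 // exprn_ge0 // ltW.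
have k0 : 0 < k.
  have : k * (1 + S) = 1 - 2 * eta by rewrite mulrDr mulr1 -tS /k; ring.
  by move=> h; rewrite -(pmulr_lgt0 _ (_ : 0 < 1 + S)) ?h; lra.
exists k, t; split; first split => //.
- by rewrite mulrC tS ler_pM2l.
- by rewrite NEk -tE.
move=> i; apply/negP => /eqP bi0.
(* The [i]-th unit direction gives [b i * mean_var p p' i = k * (p i - p' i)], whose right side is
   nonzero by the gap between [p i] and [p' i]. *)
have := NEk (fun j => (j == i)%:R); rewrite (bigD1 i) //= big1 ?addr0; last first.
  by move=> j /negbTE ->; rewrite mulr0 mul0r.
rewrite bi0 !mul0r (bigD1 i) //= eqxx mul1r big1 ?addr0; last first.
  by move=> j /negbTE ->; rewrite mul0r.
move/esym/eqP; rewrite mulf_eq0 (gt_eqF k0) /= => /eqP d0.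
by have := hd i; rewrite d0 normr0; lra.
Qed.

(** The sign [s] stands for the class; a prediction on the wrong side of [0] deviates from its mean
    [s * t] by at least [t]. *)
Lemma chebyshev_half_line q b0 b (s t : R) : (forall i, 0 <= q i <= 1) ->
  0 < t -> s ^+ 2 = 1 -> lin_mean b0 b q = s * t ->
  bern_ex q (fun x => (linpred b0 b x * s <= 0)%R%:R) <=
  (\sum_(i < n) b i * b i * (4 * q i * (1 - q i))) / t ^+ 2.
Proof.
move=> hq t0 s2 m; rewrite -bern_ex_cov mulrC -bern_exZ; apply: bern_ex_le => // x.
set l := lin_centered q b x.
have t2 : 0 < t ^+ 2 by rewrite exprn_gt0.
case: (leP (linpred b0 b x * s) 0) => h /=; last first.
  by rewrite mulr_ge0 ?invr_ge0 ?(ltW t2) // -expr2 sqr_ge0.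
rewrite mulrC ler_pdivlMr // mul1r -expr2.
move: h; rewrite (linpred_centered _ q) -/(lin_mean _ _ _) m -/l mulrDl.
have -> : s * t * s = t by rewrite mulrAC -expr2 s2 mul1r.
have -> : l ^+ 2 = (l * s) ^+ 2 by rewrite exprMn s2 mulr1.
by move: (l * s) => u h; nra.
Qed.

End ToyDistribution.

(** * Atoms and tail of the regression error *)

Section RegressionErrors.
Context {R : realType} {n : nat} (e eta : R) (p p' : 'I_n -> R) (b0 : R) (b : 'I_n -> R).
Hypotheses (n0 : (0 < n)%N) (e0 : 0 < e) (e1 : e < 1 / 2).
Hypotheses (eta0 : 0 <= eta) (eta1 : eta < 1 / 2).
Hypotheses (hp : forall i, e <= p i <= 1 - e) (hp' : forall i, e <= p' i <= 1 - e).
Hypothesis hd : forall i, e <= `|p i - p' i|.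
Hypothesis rm : risk_minimizer eta p p' b0 b.

Lemma toy_pmf_sum1 : \sum_w toy_pmf eta p p' w = 1.
Proof.
have := toy_PrE eta p p' xpredT; rewrite /toy_Pr => ->.
by rewrite toy_E_cond /outY /outZ /= !bern_ex_cst /=; field.
Qed.

Lemma sgn_mul_eqN1 y z : (sgn R y * sgn R z == -1) = (y != z).
Proof.
have one_neqN1 : (1 == -1 :> R) = false by apply/eqP; lra.
by case: y; case: z; rewrite /sgn ?mulrNN ?mulr1 ?mul1r ?one_neqN1 ?eqxx.
Qed.

Lemma toy_Pr_flip :
  toy_Pr eta p p' [pred w | sgn R (outY w) * sgn R (outZ w) == -1] = eta.
Proof.
transitivity (toy_E eta p p' (fun w => (outY w != outZ w)%:R)).
  by rewrite toy_PrE; apply: eq_bigr => w _; rewrite /= sgn_mul_eqN1.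
by rewrite toy_E_cond /outY /outZ /= !bern_ex_cst /=; field.
Qed.

Let unit_interval (q : 'I_n -> R) :
  (forall i, e <= q i <= 1 - e) -> forall i, 0 <= q i <= 1.
Proof. by move=> hq i; have /andP[? ?] := hq i; apply/andP; split; move: e0; lra. Qed.

(** Each conditional variance of the predictor is at most twice [k * t], so Chebyshev bounds the
    probability by [2 * k / t], and [t >= n * e ^+ 2 * k]. *)
Lemma toy_Pr_misclassified :
  toy_Pr eta p p' [pred w | linpred b0 b (outX w) * sgn R (outZ w) <= 0] <=
  2 / e ^+ 2 / n%:R.
Proof.
have [k [t [[k0 mp mp' tk vk] _]]] :=
  risk_minimizer_discriminant e eta p p' b0 b e0 eta0 eta1 hp hp' hd rm.
have n0' : 0 < n%:R :> R by rewrite ltr0n.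
have e2 : 0 < e ^+ 2 by rewrite exprn_gt0.
have t0 : 0 < t by apply: lt_le_trans tk; rewrite !mulr_gt0.
have class q s : (forall i, e <= q i <= 1 - e) -> s ^+ 2 = 1 ->
    lin_mean b0 b q = s * t ->
    (forall i, 2 * (q i * (1 - q i)) <= mean_var p p' i) ->
    bern_ex q (fun x => (linpred b0 b x * s <= 0)%R%:R) <= 2 / e ^+ 2 / n%:R.
  move=> hq s2 mq hv.
  apply: le_trans (chebyshev_half_line q b0 b s t (unit_interval q hq) t0 s2 mq) _.
  apply: (@le_trans _ _ (2 * (k * t) / t ^+ 2)).
    rewrite ler_pM2r ?invr_gt0 ?exprn_gt0 // -vk big_distrr; apply: ler_sum => i _ /=.
    have := hv i; have : 0 <= b i * b i by rewrite -expr2 sqr_ge0.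
    by move: (b i * b i) (mean_var p p' i) => B v B0 hvi; nra.
  have -> : 2 * (k * t) / t ^+ 2 = 2 * (k / t) by field; rewrite gt_eqF.
  rewrite -!mulrA ler_pM2l // -invfM ler_pdivrMr // mulrC ler_pdivlMr ?mulr_gt0 //.
  by rewrite mulrC (mulrC (e ^+ 2)).
have hvar (q : 'I_n -> R) : (forall i, e <= q i <= 1 - e) -> forall i, 0 <= q i * (1 - q i).
  by move=> hq i; have /andP[? ?] := hq i; move: e0 => ?; apply: mulr_ge0; lra.
rewrite toy_PrE toy_E_cond /outX /outZ /=.
have E q s : bern_ex q (fun x => (1 - eta) * (linpred b0 b x * s <= 0)%R%:R +
    eta * (linpred b0 b x * s <= 0)%R%:R) =
    bern_ex q (fun x => (linpred b0 b x * s <= 0)%R%:R).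
  by apply: bern_ex_ext => x; ring.
rewrite !E /sgn;
have : bern_ex p (fun x => (linpred b0 b x * 1 <= 0)%R%:R) <= 2 / e ^+ 2 / n%:R.
  apply: class => // [||i]; rewrite ?expr1n ?mul1r // /mean_var.
  by have := hvar p' hp' i; lra.
have : bern_ex p' (fun x => (linpred b0 b x * -1 <= 0)%R%:R) <= 2 / e ^+ 2 / n%:R.
  apply: class => // [||i]; rewrite ?sqrrN ?expr1n ?mulN1r // /mean_var.
  by have := hvar p hp i; lra.
by lra.
Qed.

(** For a fixed label the error is injective in the prediction, so each of its atoms is at most one
    atom of the predictor; the bound survives averaging over [Z] and [Y]. *)
Lemma toy_Pr_error_atom (Err : R -> bool -> R) (v : R) :
  (forall yh1 yh2 y, yh1 != yh2 -> Err yh1 y != Err yh2 y) ->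
  toy_Pr eta p p' [pred w | Err (linpred b0 b (outX w)) (outY w) == v] <=
  3 / Num.sqrt e / Num.sqrt n%:R.
Proof.
move=> inj.
have [k [t [_ hb]]] := risk_minimizer_discriminant e eta p p' b0 b e0 eta0 eta1 hp hp' hd rm.
set a := _ / _.
have a0 : 0 <= a by rewrite !divr_ge0 ?sqrtr_ge0.
have atom q y : (forall i, e <= q i <= 1 - e) ->
    bern_ex q (fun x => (Err (linpred b0 b x) y == v)%:R) <= a.
  move=> hq.
  have [/existsP[x0 /eqP x0v]|/existsPn nx] :=
    boolP [exists x : {ffun 'I_n -> bool}, Err (linpred b0 b x) y == v].
    rewrite -(bern_ex_ext _ q (fun x => (linpred b0 b x == linpred b0 b x0)%:R)).
      exact: linpred_atom.
    move=> x; congr (nat_of_bool _)%:R; rewrite -x0v.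
    have [->|ne] := eqVneq (linpred b0 b x) (linpred b0 b x0); first by rewrite eqxx.
    by rewrite (negbTE (inj _ _ _ ne)).
  rewrite (bern_ex_ext _ q _ (fun=> 0)) ?bern_ex_cst // => x.
  by rewrite (negbTE (nx x)).
rewrite toy_PrE toy_E_cond /outX /outY /= !bern_exD !bern_exZ.
have h1 := atom p true hp; have h2 := atom p false hp.
have h3 := atom p' true hp'; have h4 := atom p' false hp'.
have g (u : R) c : 0 <= c -> u <= a -> c * u <= c * a by move=> c0 ua; apply: ler_wpM2l.
have e0' : 0 <= 1 - eta by move: eta1; lra.
have := g _ _ e0' h1; have := g _ _ eta0 h2; have := g _ _ eta0 h3; have := g _ _ e0' h4.
by lra.
Qed.

(* All errors on misclassified points exceed all errors on correctly
   classified ones, so an upper level set of the error either consists of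
   misclassified points or contains all of them. *)
Lemma toy_condPr_tail (Err : R -> bool -> R) (theta a d : R) :
  good_error_function Err -> 0 < theta -> theta <= 1 -> 0 <= a -> 0 <= d ->
  (forall v, toy_Pr eta p p' [pred w | Err (linpred b0 b (outX w)) (outY w) == v] <= a) ->
  toy_Pr eta p p' [pred w | linpred b0 b (outX w) * sgn R (outZ w) <= 0] <= d ->
  let V := fun w : outcome n => Err (linpred b0 b (outX w)) (outY w) in
  let P := toy_condPr eta p p'
      [pred w | sgn R (outY w) * sgn R (outZ w) == -1]
      [pred w | 1 - theta <= toy_cdf eta p p' V (V w)] in
  1 - d / theta <= P \/
  (eta / 2 < d \/ Order.min 1 (eta / theta) - 2 * (a + d) / eta <= P).
Proof.
move=> [Err1 Err2] th0 th1 a0 d0 ha hd' V P.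
move: (eta0) (eta1) => eta_ge0 eta_lt.
have mu0 w : 0 <= toy_pmf eta p p' w.
  by apply: toy_pmf_ge0; [apply/andP; split; lra | exact: unit_interval..].
have mu1 := toy_pmf_sum1.
(* [M] is a flipped label, [B] the tail, and [W], [G] a prediction of the wrong sign for [Z],
   respectively for [Y]. Outside [W], the events [M] and [G] coincide. *)
pose M : pred (outcome n) := [pred w | sgn R (outY w) * sgn R (outZ w) == -1].
pose B : pred (outcome n) := [pred w | 1 - theta <= toy_cdf eta p p' V (V w)].
pose W : pred (outcome n) := [pred w | linpred b0 b (outX w) * sgn R (outZ w) <= 0].
pose G : pred (outcome n) := [pred w | linpred b0 b (outX w) * sgn R (outY w) <= 0].
have ME w : M w = (outY w != outZ w) by rewrite /M /= sgn_mul_eqN1.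
have MG w : M w -> G w || W w.
  rewrite ME /G /W /= /sgn; case: (outY w); case: (outZ w) => // _;
  by rewrite ?mulr1 ?mulrN1 oppr_le0; case: leP => //= /ltW ->; rewrite ?orbT.
have GM w : G w -> M w || W w.
  by rewrite ME /G /W /=; case: (outY w); case: (outZ w) => //= ->; rewrite ?orbT.
have hB : theta <= toy_Pr eta p p' B := upper_tail_ge _ V theta mu0 mu1 th1.
have hB' : toy_Pr eta p p' B <= theta + a.
  exact: upper_tail_le _ V theta a mu0 mu1 (ltW th0) a0 ha.
have hM : toy_Pr eta p p' M = eta := toy_Pr_flip.
have B0 : 0 < toy_Pr eta p p' B by apply: lt_le_trans hB.
have PE : P = toy_Pr eta p p' [pred w | M w && B w] / toy_Pr eta p p' B by [].
have Bup w w' : V w <= V w' -> B w -> B w'.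
  rewrite /B /= => VV; move/le_trans; apply; rewrite /toy_cdf /toy_Pr.
  have := sum_subset_le (toy_pmf eta p p') [pred u | V u <= V w]
    [pred u | V u <= V w'] pred0 mu0.
  by rewrite big_pred0_eq addr0; apply => u /= /le_trans ->.
rewrite PE; set pB := toy_Pr _ _ _ B in hB hB' B0 *; set pMB := toy_Pr _ _ _ _.
(* If the tail lies inside [G], all of it except a part of [W] is flipped. Otherwise it has a
   correctly classified point, hence contains [G]. *)
have [/forallP BG|/forallPn[w]] := boolP [forall w, B w ==> G w].
  left; have : pB <= pMB + d.
    apply: le_trans (sum_subset_le _ B [pred w | M w && B w] W mu0 _) (lerD (lexx _) hd').
    by move=> w Bw; rewrite /= Bw andbT; apply: GM; apply: (implyP (BG w)).
  move=> h; rewrite ler_pdivlMr // mulrBl mul1r.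
  have : d <= d / theta * pB by rewrite mulrAC ler_pdivlMr // ler_wpM2l.
  by lra.
rewrite negb_imply => /andP[Bw nGw]; right.
have GB u : G u -> B u.
  move=> Gu; apply: Bup Bw; apply/ltW/Err1 => //.
  by move: nGw; rewrite /G /= -ltNge.
have [?|dle] := ltP (eta / 2) d; [by left | right].
have h1 : eta <= pMB + d.
  rewrite -hM; apply: le_trans (sum_subset_le _ M [pred w | M w && B w] W mu0 _) (lerD (lexx _) hd').
  by move=> u Mu /=; rewrite Mu /=; have /orP[/GB->|->] := MG _ Mu; rewrite ?orbT.
have pMB_le : pMB <= pB.
  have := sum_subset_le (toy_pmf eta p p') [pred u | M u && B u] B pred0 mu0.
  by rewrite big_pred0_eq addr0; apply => u /andP[_ ->].
have pMB0 : 0 <= pMB by apply: sumr_ge0.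
(* For [eta = 0] the inverse is [0] by convention, so the error term vanishes, and the minimum is
   [0]. *)
have [eta_0|eta_neq0] := eqVneq eta 0.
  by rewrite eta_0 mul0r invr0 mulr0 subr0 min_r // divr_ge0 // ltW.
have eta_gt0 : 0 < eta by rewrite lt_neqAle eq_sym eta_neq0.
set m := Order.min _ _.
have m1 : m <= 1 by rewrite ge_min lexx.
have mth : m * theta <= eta by rewrite -ler_pdivlMr // ge_min lexx orbT.
have m0 : 0 <= m by rewrite le_min ler01 divr_ge0 // ltW.
rewrite ler_pdivlMr // mulrBl.
have : m * pB <= m * (theta + a) by apply: ler_wpM2l.
have : m * a <= a by rewrite ler_piMl.
(* The tail has mass at least [eta - d >= eta / 2], which turns the absolute loss [a + d] into a
   relative one. *)
have : a + d <= 2 * (a + d) / eta * pB.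
  have : eta / 2 <= pB by lra.
  rewrite mulrAC ler_pdivlMr // -mulrA; move: (addr_ge0 a0 d0).
  by move: (a + d) => s s0 h; nra.
by lra.
Qed.

End RegressionErrors.

(** * Choice of the constant and of the threshold for [n] *)

Theorem mainTheorem7 (R : realType) (Err : R -> bool -> R)
  (hErr : good_error_function Err) (eps eta : R) :
  0 < eps -> eps < 1 / 2 -> 0 <= eta -> eta < 1 / 2 ->
  exists C : R, 0 < C /\
  forall theta : R, 0 < theta -> theta <= 1 ->
  exists N : nat, forall n : nat, (N <= n)%N ->
  forall p p' : 'I_n -> R,
    (forall i, eps <= p i <= 1 - eps) ->
    (forall i, eps <= p' i <= 1 - eps) ->
    (forall i, eps <= `|p i - p' i|) ->
  forall (b0 : R) (b : 'I_n -> R),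
    risk_minimizer eta p p' b0 b ->
    let V := fun w : outcome n => Err (linpred b0 b (outX w)) (outY w) in
    toy_condPr eta p p'
      [pred w | sgn R (outY w) * sgn R (outZ w) == -1]
      [pred w | 1 - theta <= toy_cdf eta p p' V (V w)]
    >= Order.min 1 (eta / theta) - C / Num.sqrt (n%:R).
Proof.
move=> e0 e1 eta0 eta1.
pose A := 3 / Num.sqrt eps; pose D := 2 / eps ^+ 2.
have A0 : 0 < A by rewrite divr_gt0 ?sqrtr_gt0.
have D0 : 0 < D by rewrite divr_gt0 ?exprn_gt0.
have AD0 : 0 <= 2 * (A + D) / eta by rewrite divr_ge0 // mulr_ge0 // addr_ge0 // ltW.
(* [D] serves the case of a tail of misclassified points and keeps the constant positive when
   [eta = 0]; the other term serves the case of a larger tail. *)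
exists (D + 2 * (A + D) / eta); split; first exact: ltr_pwDl.
move=> theta th0 th1.
(* The first bound gives [D / (n * theta) <= D / sqrt n], the second excludes [eta / 2 < D / n] when
   [eta > 0]. *)
exists (Num.bound (theta ^- 2) + Num.bound (2 * D / eta)).+1 => n hn p p' hp hp' hd b0 b rm.
cbv zeta; set V := fun w : outcome n => Err (linpred b0 b (outX w)) (outY w).
have n0 : (0 < n)%N by apply: leq_trans hn.
have n0' : 0 < n%:R :> R by rewrite ltr0n.
have n_th : theta ^- 2 <= n%:R.
  apply: ltW; apply: lt_le_trans (archi_boundP _) _; first by rewrite invr_ge0 exprn_ge0 // ltW.
  by rewrite ler_nat (leq_trans _ hn) // -addnS leq_addr.
have n_eta : 2 * D / eta <= n%:R.
  apply: ltW; apply: lt_le_trans (archi_boundP _) _; first by rewrite divr_ge0 // mulr_ge0 // ltW.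
  by rewrite ler_nat (leq_trans _ hn) // leqW // leq_addl.
set s := Num.sqrt n%:R.
have s0 : 0 < s by rewrite sqrtr_gt0.
have s2 : s ^+ 2 = n%:R by rewrite sqr_sqrtr // ltW.
have s1 : 1 <= s by rewrite -sqrtr1 ler_wsqrtr // ler1n.
have s_th : theta^-1 <= s by rewrite -(@ler_pXn2r R 2) ?nnegrE ?invr_ge0 ?(ltW th0) ?(ltW s0) // exprVn s2.
have ADs : 2 * (A / s + D / n%:R) / eta <= 2 * (A + D) / eta / s.
  have -> : 2 * (A + D) / eta / s = 2 * ((A + D) / s) / eta by ring.
  apply: ler_wpM2r; first by rewrite invr_ge0.
  rewrite ler_pM2l // mulrDl lerD2l ler_pM2l // lef_pV2 ?posrE // -s2 expr2.
  by rewrite ler_peMl // ltW.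
have Ds : D / n%:R / theta <= D / s.
  have -> : D / n%:R / theta = D / s * (theta^-1 / s).
    by rewrite -s2; field; rewrite !gt_eqF.
  by rewrite ler_piMr ?ler_pdivrMr ?mul1r // divr_ge0 // ltW.
have Ds0 : 0 <= D / s by rewrite divr_ge0 // ltW.
have Es0 : 0 <= 2 * (A + D) / eta / s by rewrite divr_ge0 // ltW.
have m1 : Order.min 1 (eta / theta) <= 1 :> R by rewrite ge_min lexx.
have P0 : 0 <= toy_condPr eta p p'
      [pred w | sgn R (outY w) * sgn R (outZ w) == -1]
      [pred w | 1 - theta <= toy_cdf eta p p' V (V w)].
  have mu0 w : 0 <= toy_pmf eta p p' w.
    apply: toy_pmf_ge0; first by apply/andP; split; lra.
      by move=> i; have /andP[? ?] := hp i; apply/andP; split; lra.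
    by move=> i; have /andP[? ?] := hp' i; apply/andP; split; lra.
  by apply: divr_ge0; apply: sumr_ge0.
rewrite mulrDl.
case: (toy_condPr_tail eps eta p p' b0 b e0 eta0 eta1 hp hp' Err theta (A / s) (D / n%:R)) => //.
- by rewrite divr_ge0 // ltW.
- by rewrite divr_ge0 // ltW.
- by move=> v; apply: (toy_Pr_error_atom eps) => //; case: hErr.
- exact: toy_Pr_misclassified.
- by rewrite -/V; move: P0; lra.
case; last by rewrite -/V; move: P0; lra.
(* What remains is [eta / 2 < D / n]: for [eta = 0] the claimed lower bound is nonpositive,
   otherwise the choice of the threshold is contradicted. *)
have [eta_0|eta_neq0] := eqVneq eta 0.
  have -> : Order.min 1 (eta / theta) = 0 by rewrite eta_0 mul0r min_r.
  by rewrite -/V; move: P0 Ds0 Es0; lra.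
have eta_gt0 : 0 < eta by rewrite lt_neqAle eq_sym eta_neq0.
rewrite ltr_pdivlMr // => h; move: n_eta; rewrite ler_pdivrMr // => h'.
by lra.
Qed.
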